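(* Let $\mathcal{A}$ be an almost strict Ann-category such that every object $X$ has an object $X'$ with $X\oplus X'=O$ (the isomorphism $i_X:X\oplus X'\to O$ being the identity). Then its center $C_{\mathcal{A}}$, with the sum $+$, the product $\times$ and the braiding $c$ described in the context, is a braided Ann-category.
   Context: Write $AB$ for $A\otimes B$. An Ann-category consists of a category $\mathcal{A}$ with bifunctors $\oplus,\otimes:\mathcal{A}\times\mathcal{A}\to\mathcal{A}$ and: (i) an object $0$ (also written $O$) and natural isomorphisms $a^+_{X,Y,Z}:X\oplus(Y\oplus Z)\to(X\oplus Y)\oplus Z$, $c^+_{X,Y}:X\oplus Y\to Y\oplus X$, $g_X:0\oplus X\to X$, $d_X:X\oplus0\to X$ making $(\mathcal{A},\oplus)$ a symmetric categorical group, i.e. a symmetric monoidal category that is a groupoid and in which every object $X$ has an object $X'$ with $X\oplus X'\cong 0$; (ii) an object $1$ (also written $I$) and natural isomorphisms $a_{A,B,C}:A(BC)\to(AB)C$, $l_X:1X\to X$, $r_X:X1\to X$ making $(\mathcal{A},\otimes)$ a monoidal category; (iii) natural isomorphisms $\mathfrak{L}_{A,X,Y}:A(X\oplus Y)\to AX\oplus AY$ and $\mathfrak{R}_{X,Y,A}:(X\oplus Y)A\to XA\oplus YA$, such that the following hold for all objects. (Ann-1) The functors $A\otimes-$ (with $\mathfrak{L}_{A,-,-}$) and $-\otimes A$ (with $\mathfrak{R}_{-,-,A}$) are compatible with $a^+$ and $c^+$: $(\mathfrak{L}_{A,X,Y}\oplus \mathrm{id})\mathfrak{L}_{A,X\oplus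 Y,Z}(\mathrm{id}_A\otimes a^+_{X,Y,Z})=a^+_{AX,AY,AZ}(\mathrm{id}\oplus\mathfrak{L}_{A,Y,Z})\mathfrak{L}_{A,X,Y\oplus Z}$ and $c^+_{AX,AY}\mathfrak{L}_{A,X,Y}=\mathfrak{L}_{A,Y,X}(\mathrm{id}_A\otimes c^+_{X,Y})$, and likewise $(\mathfrak{R}_{X,Y,A}\oplus \mathrm{id})\mathfrak{R}_{X\oplus Y,Z,A}(a^+_{X,Y,Z}\otimes \mathrm{id}_A)=a^+_{XA,YA,ZA}(\mathrm{id}\oplus\mathfrak{R}_{Y,Z,A})\mathfrak{R}_{X,Y\oplus Z,A}$ and $c^+_{XA,YA}\mathfrak{R}_{X,Y,A}=\mathfrak{R}_{Y,X,A}(c^+_{X,Y}\otimes \mathrm{id}_A)$. (Ann-2) (1) $\mathfrak{L}_{AB,X,Y}\circ a_{A,B,X\oplus Y}=(a_{A,B,X}\oplus a_{A,B,Y})\circ\mathfrak{L}_{A,BX,BY}\circ(\mathrm{id}_A\otimes\mathfrak{L}_{B,X,Y})$; (2) $(a_{X,B,A}\oplus a_{Y,B,A})\circ\mathfrak{R}_{X,Y,BA}=\mathfrak{R}_{XB,YB,A}\circ(\mathfrak{R}_{X,Y,B}\otimes \mathrm{id}_A)\circ a_{X\oplus Y,B,A}$; (3) $\mathfrak{R}_{AX,AY,B}\circ(\mathfrak{L}_{A,X,Y}\otimes \mathrm{id}_B)\circ a_{A,X\oplus Y,B}=(a_{A,X,B}\oplus a_{A,Y,B})\circ\mathfrak{L}_{A,XB,YB}\circ(\mathrm{id}_A\otimes\mathfrak{R}_{X,Y,B})$;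 (4) $v\circ(\mathfrak{R}_{A,B,X}\oplus\mathfrak{R}_{A,B,Y})\circ\mathfrak{L}_{A\oplus B,X,Y}=(\mathfrak{L}_{A,X,Y}\oplus\mathfrak{L}_{B,X,Y})\circ\mathfrak{R}_{A,B,X\oplus Y}$, where $v=v_{U,V,Z,T}:(U\oplus V)\oplus(Z\oplus T)\to(U\oplus Z)\oplus(V\oplus T)$ is the canonical isomorphism built from $a^+,c^+,\mathrm{id}$ (interchanging $V$ and $Z$). (Ann-3) (5.1) $(l_X\oplus l_Y)\circ\mathfrak{L}_{1,X,Y}=l_{X\oplus Y}$; (5.2) $(r_X\oplus r_Y)\circ\mathfrak{R}_{X,Y,1}=r_{X\oplus Y}$. A braided Ann-category is an Ann-category with a natural isomorphism $c_{A,B}:AB\to BA$ such that $(\mathcal{A},\otimes,a,c,(1,l,r))$ is a braided tensor (monoidal) category, with $c_{0,0}=\mathrm{id}$ and (6) $\mathfrak{R}_{X,Y,A}\circ c_{A,X\oplus Y}=(c_{A,X}\oplus c_{A,Y})\circ\mathfrak{L}_{A,X,Y}$. An Ann-category is almost strict if all its natural constraints except $c^+$ and $\mathfrak{L}$ are identities (so $a^+,g,d,a,l,r,\mathfrak{R}$ are identities). Center $C_{\mathcal{A}}$ of an almost strict Ann-category: objects are pairs $(A,u)$ with $A$ an object of $\mathcal{A}$ and $u_X:AX\to XA$ a transformation natural in $X$ such that (C1) $u_I=\mathrm{id}$; (C2) $u_{XY}=(\mathrm{id}_X\otimes u_Y)\circ(u_X\otimes \mathrm{id}_Y)$; (C3)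 $u_{X\oplus Y}=(u_X\oplus u_Y)\circ\mathfrak{L}_{A,X,Y}$. A morphism $f:(A,u)\to(B,m)$ is a morphism $f:A\to B$ of $\mathcal{A}$ with $m_X\circ(f\otimes \mathrm{id}_X)=(\mathrm{id}_X\otimes f)\circ u_X$ for all $X$. Sum: $(A,u)+(B,m)=(A\oplus B,u+m)$ with $(u+m)_X=\mathfrak{L}_{X,A,B}^{-1}\circ(u_X\oplus m_X)$, and the sum of morphisms is that of $\mathcal{A}$. Product: $(A,u)\times(B,m)=(AB,u\times m)$ with $(u\times m)_X=(u_X\otimes \mathrm{id}_B)\circ(\mathrm{id}_A\otimes m_X)$, and the product of morphisms is their tensor product in $\mathcal{A}$. Braiding: $c_{(A,u),(B,m)}=u_B:(A,u)\times(B,m)\to(B,m)\times(A,u)$. *)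

(* Defs.v *)
From Stdlib Require Import ProofIrrelevance.

Set Implicit Arguments.
Unset Strict Implicit.
Unset Printing Implicit Defensive.

Declare Scope cat_scope.
Delimit Scope cat_scope with cat.
Open Scope cat_scope.

(** * Categories *)

Record category := Category {
  ob :> Type;
  hom : ob -> ob -> Type;
  idm : forall X, hom X X;
  comp : forall X Y Z, hom Y Z -> hom X Y -> hom X Z;
  comp_idl : forall X Y (f : hom X Y), comp (idm Y) f = f;
  comp_idr : forall X Y (f : hom X Y), comp f (idm X) = f;
  compA : forall X Y Z T (h : hom Z T) (g : hom Y Z) (f : hom X Y),
    comp h (comp g f) = comp (comp h g) f
}.

Arguments hom {_} _ _.
Arguments idm {_} _.
Arguments comp {_} {_ _ _} _ _.

Notation "g ∘ f" := (comp g f) (at level 40, left associativity) : cat_scope.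

(* Equality of two arrows whose ends are not assumed to be the same objects:
   it says that the sources agree, the targets agree and the arrows agree. *)
Inductive arrow_eq (C : category) (X Y : C) (f : hom X Y) :
  forall X' Y' : C, hom X' Y' -> Prop :=
| Arrow_eq : arrow_eq f f.

(* [f : hom X Y] is an identity arrow; in particular [X = Y]. *)
Inductive is_identity (C : category) : forall X Y : C, hom X Y -> Prop :=
| Is_identity (X : C) : is_identity (idm X).

Record iso (C : category) (X Y : C) := Iso {
  iso_hom :> hom X Y;
  iso_inv : hom Y X;
  isoK : iso_inv ∘ iso_hom = idm X;
  isoVK : iso_hom ∘ iso_inv = idm Y
}.

Definition groupoid (C : category) : Prop :=
  forall (X Y : C) (f : hom X Y),
    exists g : hom Y X, g ∘ f = idm X /\ f ∘ g = idm Y.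

Record bifunctor (C : category) := Bifunctor {
  bi_ob :> C -> C -> C;
  bi_hom : forall X X' Y Y',
    hom X X' -> hom Y Y' -> hom (bi_ob X Y) (bi_ob X' Y');
  bi_id : forall X Y, bi_hom (idm X) (idm Y) = idm (bi_ob X Y);
  bi_comp : forall X X' X'' Y Y' Y''
    (f : hom X X') (f' : hom X' X'') (g : hom Y Y') (g' : hom Y' Y''),
    bi_hom (f' ∘ f) (g' ∘ g) = bi_hom f' g' ∘ bi_hom f g
}.

(** * Monoidal, braided and symmetric structures *)

(* The associator goes from the right-bracketed to the left-bracketed product. *)
Record monoidal (C : category) := Monoidal {
  tensor :> bifunctor C;
  munit : C;
  assoc : forall X Y Z, iso (tensor X (tensor Y Z)) (tensor (tensor X Y) Z);
  lunit : forall X, iso (tensor munit X) X;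
  runit : forall X, iso (tensor X munit) X;
  assoc_nat : forall X X' Y Y' Z Z'
    (f : hom X X') (g : hom Y Y') (h : hom Z Z'),
    assoc X' Y' Z' ∘ bi_hom tensor f (bi_hom tensor g h)
    = bi_hom tensor (bi_hom tensor f g) h ∘ assoc X Y Z;
  lunit_nat : forall X Y (f : hom X Y),
    lunit Y ∘ bi_hom tensor (idm munit) f = f ∘ lunit X;
  runit_nat : forall X Y (f : hom X Y),
    runit Y ∘ bi_hom tensor f (idm munit) = f ∘ runit X;
  pentagon : forall X Y Z T,
    assoc (tensor X Y) Z T ∘ assoc X Y (tensor Z T)
    = bi_hom tensor (assoc X Y Z) (idm T) ∘ assoc X (tensor Y Z) T
      ∘ bi_hom tensor (idm X) (assoc Y Z T);
  triangle : forall X Y,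
    bi_hom tensor (runit X) (idm Y) ∘ assoc X munit Y
    = bi_hom tensor (idm X) (lunit Y)
}.

Record is_braiding (C : category) (M : monoidal C)
    (c : forall X Y : C, iso (M X Y) (M Y X)) : Prop := IsBraiding {
  braiding_nat : forall X X' Y Y' (f : hom X X') (g : hom Y Y'),
    c X' Y' ∘ bi_hom M f g = bi_hom M g f ∘ c X Y;
  hexagon1 : forall X Y Z,
    bi_hom M (c X Z) (idm Y) ∘ assoc M X Z Y ∘ bi_hom M (idm X) (c Y Z)
    = assoc M Z X Y ∘ c (M X Y) Z ∘ assoc M X Y Z;
  hexagon2 : forall X Y Z,
    bi_hom M (idm Y) (c X Z) ∘ iso_inv (assoc M Y X Z)
      ∘ bi_hom M (c X Y) (idm Z)
    = iso_inv (assoc M Y Z X) ∘ c X (M Y Z) ∘ iso_inv (assoc M X Y Z)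
}.

Record is_symmetry (C : category) (M : monoidal C)
    (c : forall X Y : C, iso (M X Y) (M Y X)) : Prop := IsSymmetry {
  symmetry_braiding : is_braiding c;
  symmetry_invol : forall X Y, c Y X ∘ c X Y = idm (M X Y)
}.

Record is_symmetric_categorical_group (C : category) (M : monoidal C)
    (c : forall X Y : C, iso (M X Y) (M Y X)) : Prop := IsSymCatGroup {
  scg_symmetry : is_symmetry c;
  scg_groupoid : groupoid C;
  scg_inverse : forall X : C, exists X' : C, inhabited (iso (M X X') (munit M))
}.

(** * Ann-categories *)

Section AnnLaws.

Variables (C : category) (P M : monoidal C).

Local Notation "X ⊕ Y" := (bi_ob P X Y) (at level 50, left associativity).
Local Notation "X ⊗ Y" := (bi_ob M X Y) (at level 40, left associativity).
Local Notation "f ⊞ g" := (bi_hom P f g) (at level 38, left associativity).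
Local Notation "f ⊠ g" := (bi_hom M f g) (at level 38, left associativity).
Local Notation "'a+'" := (assoc P).
Local Notation a := (assoc M).

(* (U ⊕ V) ⊕ (Z ⊕ T) -> ((U ⊕ V) ⊕ Z) ⊕ T -> (U ⊕ (V ⊕ Z)) ⊕ T
   -> (U ⊕ (Z ⊕ V)) ⊕ T -> ((U ⊕ Z) ⊕ V) ⊕ T -> (U ⊕ Z) ⊕ (V ⊕ T) *)
Definition interchange (c : forall X Y : C, iso (X ⊕ Y) (Y ⊕ X))
    (U V Z T : C) : hom ((U ⊕ V) ⊕ (Z ⊕ T)) ((U ⊕ Z) ⊕ (V ⊕ T)) :=
  iso_inv (a+ (U ⊕ Z) V T)
  ∘ (a+ U Z V ⊞ idm T)
  ∘ ((idm U ⊞ c V Z) ⊞ idm T)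
  ∘ (iso_inv (a+ U V Z) ⊞ idm T)
  ∘ a+ (U ⊕ V) Z T.

Record ann_laws
    (c : forall X Y : C, iso (X ⊕ Y) (Y ⊕ X))
    (L : forall A X Y : C, iso (A ⊗ (X ⊕ Y)) (A ⊗ X ⊕ A ⊗ Y))
    (R : forall X Y A : C, iso ((X ⊕ Y) ⊗ A) (X ⊗ A ⊕ Y ⊗ A)) : Prop :=
  AnnLaws {
  distL_nat : forall A A' X X' Y Y'
    (f : hom A A') (g : hom X X') (h : hom Y Y'),
    L A' X' Y' ∘ (f ⊠ (g ⊞ h)) = ((f ⊠ g) ⊞ (f ⊠ h)) ∘ L A X Y;
  distR_nat : forall X X' Y Y' A A'
    (g : hom X X') (h : hom Y Y') (f : hom A A'),
    R X' Y' A' ∘ ((g ⊞ h) ⊠ f) = ((g ⊠ f) ⊞ (h ⊠ f)) ∘ R X Y A;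
  ann1_La : forall A X Y Z,
    (L A X Y ⊞ idm (A ⊗ Z)) ∘ L A (X ⊕ Y) Z ∘ (idm A ⊠ a+ X Y Z)
    = a+ (A ⊗ X) (A ⊗ Y) (A ⊗ Z) ∘ (idm (A ⊗ X) ⊞ L A Y Z) ∘ L A X (Y ⊕ Z);
  ann1_Lc : forall A X Y,
    c (A ⊗ X) (A ⊗ Y) ∘ L A X Y = L A Y X ∘ (idm A ⊠ c X Y);
  ann1_Ra : forall X Y Z A,
    (R X Y A ⊞ idm (Z ⊗ A)) ∘ R (X ⊕ Y) Z A ∘ (a+ X Y Z ⊠ idm A)
    = a+ (X ⊗ A) (Y ⊗ A) (Z ⊗ A) ∘ (idm (X ⊗ A) ⊞ R Y Z A) ∘ R X (Y ⊕ Z) A;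
  ann1_Rc : forall X Y A,
    c (X ⊗ A) (Y ⊗ A) ∘ R X Y A = R Y X A ∘ (c X Y ⊠ idm A);
  ann2_1 : forall A B X Y,
    L (A ⊗ B) X Y ∘ a A B (X ⊕ Y)
    = (a A B X ⊞ a A B Y) ∘ L A (B ⊗ X) (B ⊗ Y) ∘ (idm A ⊠ L B X Y);
  ann2_2 : forall X Y B A,
    (a X B A ⊞ a Y B A) ∘ R X Y (B ⊗ A)
    = R (X ⊗ B) (Y ⊗ B) A ∘ (R X Y B ⊠ idm A) ∘ a (X ⊕ Y) B A;
  ann2_3 : forall A X Y B,
    R (A ⊗ X) (A ⊗ Y) B ∘ (L A X Y ⊠ idm B) ∘ a A (X ⊕ Y) B
    = (a A X B ⊞ a A Y B) ∘ L A (X ⊗ B) (Y ⊗ B) ∘ (idm A ⊠ R X Y B);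
  ann2_4 : forall A B X Y,
    interchange c (A ⊗ X) (B ⊗ X) (A ⊗ Y) (B ⊗ Y)
      ∘ (R A B X ⊞ R A B Y) ∘ L (A ⊕ B) X Y
    = (L A X Y ⊞ L B X Y) ∘ R A B (X ⊕ Y);
  ann3_L : forall X Y,
    (lunit M X ⊞ lunit M Y) ∘ L (munit M) X Y = lunit M (X ⊕ Y);
  ann3_R : forall X Y,
    (runit M X ⊞ runit M Y) ∘ R X Y (munit M) = runit M (X ⊕ Y)
}.

End AnnLaws.

(* [addA], [addl], [addr], [addC] are a^+, g, d, c^+, and
   [mulA], [mull], [mulr], [distL], [distR] are a, l, r, L, R. *)
Record ann_structure (C : category) := AnnStructure {
  add : monoidal C;
  addC : forall X Y : C, iso (add X Y) (add Y X);
  mul : monoidal C;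
  distL : forall A X Y : C, iso (mul A (add X Y)) (add (mul A X) (mul A Y));
  distR : forall X Y A : C, iso (mul (add X Y) A) (add (mul X A) (mul Y A));
  add_scg : is_symmetric_categorical_group addC;
  ann_ax : ann_laws addC distL distR
}.

Definition zero {C : category} (A : ann_structure C) : C := munit (add A).
Definition one {C : category} (A : ann_structure C) : C := munit (mul A).
Notation addA A := (assoc (add A)).
Notation addl A := (lunit (add A)).
Notation addr A := (runit (add A)).
Notation mulA A := (assoc (mul A)).
Notation mull A := (lunit (mul A)).
Notation mulr A := (runit (mul A)).

Record braided_ann_structure (C : category) := BraidedAnnStructure {
  braided_ann :> ann_structure C;
  braid : forall X Y : C, iso (mul braided_ann X Y) (mul braided_ann Y X);
  braid_braiding : is_braiding braid;
  braid_zero :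
    iso_hom (braid (zero braided_ann) (zero braided_ann)) = idm _;
  braid_dist : forall A X Y,
    distR braided_ann X Y A ∘ braid A (add braided_ann X Y)
    = bi_hom (add braided_ann) (braid A X) (braid A Y)
      ∘ distL braided_ann A X Y
}.

Record almost_strict (C : category) (A : ann_structure C) : Prop :=
  AlmostStrict {
  strict_addA : forall X Y Z, is_identity (addA A X Y Z);
  strict_addl : forall X, is_identity (addl A X);
  strict_addr : forall X, is_identity (addr A X);
  strict_mulA : forall X Y Z, is_identity (mulA A X Y Z);
  strict_mull : forall X, is_identity (mull A X);
  strict_mulr : forall X, is_identity (mulr A X);
  strict_distR : forall X Y Z, is_identity (distR A X Y Z)
}.

(** * The center *)

(* In an almost strict Ann-category, a formula such as
     u_{XY} = (id_X ⊗ u_Y) ∘ (u_X ⊗ id_Y)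
   tacitly uses equalities of objects such as (XA)Y = X(AY). Below, the
   corresponding constraint (a, l, r or R), which is then an identity arrow,
   is inserted wherever this happens, so that the formulas are well typed. *)

Section Center.

Variables (C : category) (A : ann_structure C).

Local Notation "X ⊕ Y" := (bi_ob (add A) X Y) (at level 50, left associativity).
Local Notation "X ⊗ Y" := (bi_ob (mul A) X Y) (at level 40, left associativity).
Local Notation "f ⊞ g" :=
  (bi_hom (add A) f g) (at level 38, left associativity).
Local Notation "f ⊠ g" :=
  (bi_hom (mul A) f g) (at level 38, left associativity).

Record half_braided := HalfBraided {
  carrier :> C;
  hb : forall X : C, hom (carrier ⊗ X) (X ⊗ carrier)
}.

Record is_central (U : half_braided) : Prop := IsCentral {
  hb_nat : forall X Y (f : hom X Y),
    hb U Y ∘ (idm U ⊠ f) = (f ⊠ idm U) ∘ hb U X;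
  hb_one : mull A U ∘ hb U (one A) = mulr A U;
  hb_mul : forall X Y,
    hb U (X ⊗ Y)
    = mulA A X Y U ∘ (idm X ⊠ hb U Y) ∘ iso_inv (mulA A X U Y)
      ∘ (hb U X ⊠ idm Y) ∘ mulA A U X Y;
  hb_add : forall X Y,
    distR A X Y U ∘ hb U (X ⊕ Y) = (hb U X ⊞ hb U Y) ∘ distL A U X Y
}.

Record center_ob := CenterOb {
  half :> half_braided;
  half_central : is_central half
}.

Definition is_center_hom (U V : half_braided) (f : hom U V) : Prop :=
  forall X : C, hb V X ∘ (f ⊠ idm X) = (idm X ⊠ f) ∘ hb U X.

Record center_hom (U V : center_ob) := CenterHom {
  under : hom U V;
  under_center : is_center_hom under
}.

Lemma center_hom_eq (U V : center_ob) (f g : center_hom U V) :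
  under f = under g -> f = g.
Proof.
destruct f as [f Hf], g as [g Hg]; simpl; intros e; subst g.
now rewrite (proof_irrelevance _ Hf Hg).
Qed.

Lemma is_center_hom_id (U : half_braided) : is_center_hom (idm U).
Proof. now intros X; rewrite !bi_id, comp_idl, comp_idr. Qed.

Lemma is_center_hom_comp (U V W : half_braided) (g : hom V W) (f : hom U V) :
  is_center_hom g -> is_center_hom f -> is_center_hom (g ∘ f).
Proof.
intros Hg Hf X; rewrite <- (comp_idl (idm X)), !bi_comp.
now rewrite compA, Hg, <- compA, Hf, compA.
Qed.

Definition center_id (U : center_ob) : center_hom U U :=
  CenterHom (is_center_hom_id U).

Definition center_comp (U V W : center_ob)
    (g : center_hom V W) (f : center_hom U V) : center_hom U W :=
  CenterHom (is_center_hom_comp (under_center g) (under_center f)).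

Definition center : category.
Proof.
refine (@Category center_ob center_hom center_id center_comp _ _ _);
  intros; apply center_hom_eq; simpl.
- apply comp_idl.
- apply comp_idr.
- apply compA.
Defined.

Definition half_add (U V : half_braided) : half_braided :=
  @HalfBraided (U ⊕ V) (fun X =>
    iso_inv (distL A X U V) ∘ (hb U X ⊞ hb V X) ∘ distR A U V X).

Definition half_mul (U V : half_braided) : half_braided :=
  @HalfBraided (U ⊗ V) (fun X =>
    iso_inv (mulA A X U V) ∘ (hb U X ⊠ idm V) ∘ mulA A U X V
    ∘ (idm U ⊠ hb V X) ∘ iso_inv (mulA A U V X)).

End Center.

(* The underlying arrow in [C] of an arrow of the center. *)
Definition forget {C : category} {A : ann_structure C} {U V : center A}
    (f : hom U V) : hom (carrier U) (carrier V) := under f.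

(* The sum, product and braiding of [B] are those prescribed on the center. *)
Record center_operations (C : category) (A : ann_structure C)
    (B : braided_ann_structure (center A)) : Prop := CenterOperations {
  center_addE : forall U V : center A,
    half (add B U V) = half_add (half U) (half V);
  center_add_homE : forall (U U' V V' : center A)
    (f : hom U U') (g : hom V V'),
    arrow_eq (forget (bi_hom (add B) f g))
             (bi_hom (add A) (forget f) (forget g));
  center_mulE : forall U V : center A,
    half (mul B U V) = half_mul (half U) (half V);
  center_mul_homE : forall (U U' V V' : center A)
    (f : hom U U') (g : hom V V'),
    arrow_eq (forget (bi_hom (mul B) f g))
             (bi_hom (mul A) (forget f) (forget g));
  center_braidE : forall U V : center A,
    arrow_eq (forget (braid B U V)) (hb (half U) (carrier V))
}.

(* The remaining structure of [B] is carried by the one of [A]. *)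
Record center_constraints (C : category) (A : ann_structure C)
    (B : braided_ann_structure (center A)) : Prop := CenterConstraints {
  center_zeroE : carrier (half (zero B)) = zero A;
  center_oneE : carrier (half (one B)) = one A;
  center_addAE : forall U V W : center A,
    arrow_eq (forget (addA B U V W)) (addA A (carrier U) (carrier V) (carrier W));
  center_addCE : forall U V : center A,
    arrow_eq (forget (addC B U V)) (addC A (carrier U) (carrier V));
  center_addlE : forall U : center A,
    arrow_eq (forget (addl B U)) (addl A (carrier U));
  center_addrE : forall U : center A,
    arrow_eq (forget (addr B U)) (addr A (carrier U));
  center_mulAE : forall U V W : center A,
    arrow_eq (forget (mulA B U V W)) (mulA A (carrier U) (carrier V) (carrier W));
  center_mullE : forall U : center A,
    arrow_eq (forget (mull B U)) (mull A (carrier U));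
  center_mulrE : forall U : center A,
    arrow_eq (forget (mulr B U)) (mulr A (carrier U));
  center_distLE : forall U V W : center A,
    arrow_eq (forget (distL B U V W))
             (distL A (carrier U) (carrier V) (carrier W));
  center_distRE : forall U V W : center A,
    arrow_eq (forget (distR B U V W))
             (distR A (carrier U) (carrier V) (carrier W))
}.

(* Main.v *)
(** In an almost strict Ann-category the formulas defining the center become
literal identities once arrows are compared without fixing their ends, so the
computations are made with untyped arrows.

The key point is the following. Let [m], [n], [w] be families of arrows on
[U], [V], [U ⊕ V] with [L_{X,U,V} w_X = m_X ⊕ n_X] for all [X]. Then [L] carries
each side of each of naturality, (C1), (C2), (C3) for [w] to the direct sum of
the corresponding sides for [m] and [n]. Three consequences follow:
- the sum of two objects of the center is an object of the center;
- the arrows [u_X : 0 = 0X -> X0] with [L_{X,0,0} u_X = u_X ⊕ u_X] exist and are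
  unique because objects are strictly invertible for [⊕]; both sides of each
  axiom satisfy this equation, so [(0, u)] is in the center;
- if [U ⊕ V = 0], the solution [n] of [m_X ⊕ n_X = L_{X,U,V} u_X] makes [(V, n)]
  an opposite of [(U, m)], since [⊕] is cancellative.
All the laws of a braided Ann-category then hold because they hold for the
underlying arrows. *)

From Stdlib Require Import ProofIrrelevance ClassicalEpsilon.
Require Import Defs.

Set Implicit Arguments.
Unset Strict Implicit.
Unset Printing Implicit Defensive.

(** * Untyped arrows *)

Section Arrows.

Variable C : category.

(* [Null] is absorbing and stands for an ill-typed composite: composition is then
   total, and associative without side conditions. *)
Inductive arrow : Type :=
| Null
| Arr (X Y : C) (f : hom X Y).

Definition ident (X : C) : arrow := Arr (idm X).

(** Whether the ends match is decided classically, and [f] is transported along the resulting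
    equality of objects. By proof irrelevance that equality becomes [eq_refl] whenever the ends
    match on the nose. *)
Definition acomp (g f : arrow) : arrow :=
  match g, f with
  | @Arr Y' Z g, @Arr X Y f =>
    match excluded_middle_informative (Y = Y') with
    | left e => Arr (g ∘ eq_rect Y (hom X) f Y' e)
    | right _ => Null
    end
  | _, _ => Null
  end.

Definition alift (F : bifunctor C) (f g : arrow) : arrow :=
  match f, g with
  | Arr f, Arr g => Arr (bi_hom F f g)
  | _, _ => Null
  end.

Definition defined (f : arrow) : Prop := f <> Null.

(** The ends are mere arguments of a proposition, so they can be rewritten along equalities of
    objects without transporting [f]. *)
Definition typed (f : arrow) (X Y : C) : Prop := exists h : hom X Y, f = Arr h.

Lemma Arr_inj (X Y : C) (f g : hom X Y) : Arr f = Arr g -> f = g.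
Proof.
intros e; injection e; intros e'.
now apply inj_pair2 in e'; apply inj_pair2 in e'.
Qed.

Lemma Arr_comp (X Y Z : C) (g : hom Y Z) (f : hom X Y) :
  Arr (g ∘ f) = acomp (Arr g) (Arr f).
Proof.
simpl; destruct (excluded_middle_informative (Y = Y)) as [e|n].
- now rewrite (proof_irrelevance _ e eq_refl).
- now destruct n.
Qed.

Lemma acomp_Null (f : arrow) : acomp f Null = Null.
Proof. now destruct f. Qed.

Lemma acompA (h g f : arrow) : acomp h (acomp g f) = acomp (acomp h g) f.
Proof.
destruct h as [|Z' T h], g as [|Y' Z g], f as [|X Y f]; rewrite ?acomp_Null;
  trivial; simpl;
  destruct (excluded_middle_informative (Y = Y')) as [eY|nY];
  destruct (excluded_middle_informative (Z = Z')) as [eZ|nZ]; trivial.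
- subst Y' Z'; simpl.
  destruct (excluded_middle_informative (Z = Z)) as [eZ|n]; [|now destruct n].
  destruct (excluded_middle_informative (Y = Y)) as [eY|n]; [|now destruct n].
  rewrite (proof_irrelevance _ eY eq_refl).
  simpl; now rewrite compA.
- simpl; destruct (excluded_middle_informative (Y = Y')) as [e|n]; trivial.
  now destruct (nY e).
Qed.

Lemma defined_acomp (g f : arrow) :
  defined (acomp g f) ->
  exists (X Y Z : C) (g' : hom Y Z) (f' : hom X Y), g = Arr g' /\ f = Arr f'.
Proof.
destruct g as [|Y' Z g], f as [|X Y f]; intros d; try now destruct d.
revert d; simpl; destruct (excluded_middle_informative (Y = Y')) as [e|n];
  intros d; [|now destruct d].
subst Y'; now exists X, Y, Z, g, f.
Qed.

(** Definedness of the composite forces [X] to be the target of [f]; otherwise the left side is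
    [Null]. *)
Lemma ident_l (X : C) (f : arrow) : defined (acomp (ident X) f) ->
  acomp (ident X) f = f.
Proof.
intros d; destruct (defined_acomp d) as (X' & Y & Z & g & f' & eg & ->).
injection eg; intros _ eZ eY; subst Y Z.
apply Arr_inj in eg; subst g.
unfold ident; now rewrite <- Arr_comp, comp_idl.
Qed.

Lemma ident_r (X : C) (f : arrow) : defined (acomp f (ident X)) ->
  acomp f (ident X) = f.
Proof.
intros d; destruct (defined_acomp d) as (X' & Y & Z & f' & g & -> & eg).
injection eg; intros _ eZ eY; subst X' Y.
apply Arr_inj in eg; subst g.
unfold ident; now rewrite <- Arr_comp, comp_idr.
Qed.

Lemma alift_ident (F : bifunctor C) (X Y : C) :
  alift F (ident X) (ident Y) = ident (F X Y).
Proof. simpl; now rewrite bi_id. Qed.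

(** The two composites must be defined separately: the values of [F] at their middle objects may
    agree even when these objects do not. *)
Lemma alift_acomp (F : bifunctor C) (f' f g' g : arrow) :
  defined (acomp f' f) -> defined (acomp g' g) ->
  alift F (acomp f' f) (acomp g' g) = acomp (alift F f' g') (alift F f g).
Proof.
intros df dg.
destruct (defined_acomp df) as (X & Y & Z & F' & G & -> & ->).
destruct (defined_acomp dg) as (X1 & Y1 & Z1 & F1 & G1 & -> & ->).
rewrite <- !Arr_comp; unfold alift; now rewrite bi_comp, Arr_comp.
Qed.

Lemma alift_acompl (F : bifunctor C) (X : C) (g' g : arrow) :
  defined (acomp g' g) ->
  alift F (ident X) (acomp g' g)
  = acomp (alift F (ident X) g') (alift F (ident X) g).
Proof.
intros d; rewrite <- alift_acomp; trivial;
  unfold ident; rewrite <- Arr_comp, comp_idl; easy.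
Qed.

Lemma alift_acompr (F : bifunctor C) (X : C) (g' g : arrow) :
  defined (acomp g' g) ->
  alift F (acomp g' g) (ident X)
  = acomp (alift F g' (ident X)) (alift F g (ident X)).
Proof.
intros d; rewrite <- alift_acomp; trivial;
  unfold ident; rewrite <- Arr_comp, comp_idl; easy.
Qed.

Lemma typed_Arr (X Y : C) (f : hom X Y) : typed (Arr f) X Y.
Proof. now exists f. Qed.

Lemma typed_ident (X : C) : typed (ident X) X X.
Proof. now exists (idm X). Qed.

Lemma typed_conv (f : arrow) (X Y X' Y' : C) :
  typed f X Y -> X = X' -> Y = Y' -> typed f X' Y'.
Proof. now intros t <- <-. Qed.

Lemma typed_acomp (g f : arrow) (X Y Y' Z : C) :
  typed g Y' Z -> typed f X Y -> Y = Y' -> typed (acomp g f) X Z.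
Proof.
intros [g' ->] [f' ->] <-; exists (g' ∘ f'); now rewrite Arr_comp.
Qed.

Lemma typed_alift (F : bifunctor C) (f g : arrow) (X X' Y Y' : C) :
  typed f X X' -> typed g Y Y' -> typed (alift F f g) (F X Y) (F X' Y').
Proof. now intros [f' ->] [g' ->]; exists (bi_hom F f' g'). Qed.

Lemma typed_defined (f : arrow) (X Y : C) : typed f X Y -> defined f.
Proof. now intros [f' ->]. Qed.

Lemma identity_Arr (X Y : C) (f : hom X Y) :
  is_identity f -> X = Y /\ Arr f = ident X.
Proof. now intros []. Qed.

Lemma identity_inv (X Y : C) (f : iso X Y) :
  is_identity f -> is_identity (iso_inv f).
Proof.
destruct f as [f g fg gf]; simpl; intros i; destruct i.
rewrite comp_idl in gf; rewrite gf; constructor.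
Qed.

Lemma Arr_identity_l (X Y Z : C) (g : hom Y Z) (f : hom X Y) :
  is_identity g -> Arr (g ∘ f) = Arr f.
Proof. intros i; revert f; destruct i; intros f; now rewrite comp_idl. Qed.

Lemma Arr_identity_r (X Y Z : C) (g : hom Y Z) (f : hom X Y) :
  is_identity f -> Arr (g ∘ f) = Arr g.
Proof. intros i; revert g; destruct i; intros g; now rewrite comp_idr. Qed.

End Arrows.

Arguments Null {C}.
Arguments typed_ident {C} X.
Arguments acomp {C} g f : simpl never.
Arguments alift {C} F f g : simpl never.

(** * Almost strict Ann-categories *)

Section Strict.

Variables (C : category) (A : ann_structure C).
Hypothesis hA : almost_strict A.
Hypothesis hinv : forall X : C, exists X' : C, add A X X' = zero A.

Local Notation "X ⊕ Y" := (bi_ob (add A) X Y) (at level 50, left associativity).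
Local Notation "X ⊗ Y" := (bi_ob (mul A) X Y) (at level 40, left associativity).
Local Notation "f ⊞ g" := (alift (add A) f g) (at level 38, left associativity).
Local Notation "f ⊠ g" := (alift (mul A) f g) (at level 36, left associativity).
Local Notation "g • f" := (acomp g f) (at level 45, left associativity).
Local Notation "'ι' X" := (ident X) (at level 9, X at level 9).
Local Notation arrow := (arrow C).
Local Notation O := (zero A).
Local Notation I := (one A).

Definition dl (X Y Z : C) : arrow := Arr (distL A X Y Z).
Definition ac (X Y : C) : arrow := Arr (addC A X Y).

Lemma ob_addA (X Y Z : C) : X ⊕ (Y ⊕ Z) = X ⊕ Y ⊕ Z.
Proof. exact (proj1 (identity_Arr (strict_addA hA X Y Z))). Qed.

Lemma ob_addl (X : C) : O ⊕ X = X.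
Proof. exact (proj1 (identity_Arr (strict_addl hA X))). Qed.

Lemma ob_addr (X : C) : X ⊕ O = X.
Proof. exact (proj1 (identity_Arr (strict_addr hA X))). Qed.

Lemma ob_mulA (X Y Z : C) : X ⊗ (Y ⊗ Z) = X ⊗ Y ⊗ Z.
Proof. exact (proj1 (identity_Arr (strict_mulA hA X Y Z))). Qed.

Lemma ob_mull (X : C) : I ⊗ X = X.
Proof. exact (proj1 (identity_Arr (strict_mull hA X))). Qed.

Lemma ob_mulr (X : C) : X ⊗ I = X.
Proof. exact (proj1 (identity_Arr (strict_mulr hA X))). Qed.

Lemma ob_distR (X Y Z : C) : (X ⊕ Y) ⊗ Z = X ⊗ Z ⊕ Y ⊗ Z.
Proof. exact (proj1 (identity_Arr (strict_distR hA X Y Z))). Qed.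

(** Objects form a strict monoid under the sum in which every element has a right inverse, hence a
    group; [e2] is the left inverse. *)
Lemma ob_addI (X Y Z : C) : X ⊕ Y = X ⊕ Z -> Y = Z.
Proof.
destruct (hinv X) as [X' e]; destruct (hinv X') as [X'' e'].
assert (e2 : X' ⊕ X = O).
{ rewrite <- (ob_addr (X' ⊕ X)), <- e', <- ob_addA, (ob_addA X X' X''), e.
  now rewrite ob_addl. }
intros h; rewrite <- (ob_addl Y), <- e2, <- ob_addA, h, ob_addA, e2.
apply ob_addl.
Qed.

Lemma ob_opp (X : C) : exists X', X ⊕ X' = O /\ X' ⊕ X = O.
Proof.
destruct (hinv X) as [X' e]; exists X'; split; trivial.
apply (ob_addI (X := X)); now rewrite ob_addA, e, ob_addl, ob_addr.
Qed.

(** Strict right distributivity gives [OX = OX ⊕ OX], and cancellation concludes. The argument does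
    not apply to [X ⊗ O], because L is not strict. *)
Lemma ob_mul0 (X : C) : O ⊗ X = O.
Proof.
apply (ob_addI (X := O ⊗ X)).
now rewrite <- ob_distR, ob_addl, ob_addr.
Qed.

Ltac ob :=
  cbn [carrier half_add half_mul];
  try reflexivity; rewrite ?ob_distR;
  repeat progress rewrite ?ob_addA, ?ob_addl, ?ob_addr, ?ob_mulA, ?ob_mull,
    ?ob_mulr, ?ob_distR, ?ob_mul0;
  try reflexivity.

Definition hba (U : half_braided A) (X : C) : arrow := Arr (hb U X).

Lemma typed_hba (U : half_braided A) (X : C) :
  typed (hba U X) (U ⊗ X) (X ⊗ U).
Proof. apply typed_Arr. Qed.

Lemma Arr_hb (U : half_braided A) (X : C) : Arr (hb U X) = hba U X.
Proof. reflexivity. Qed.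

Lemma typed_dl (X Y Z : C) : typed (dl X Y Z) (X ⊗ (Y ⊕ Z)) (X ⊗ Y ⊕ X ⊗ Z).
Proof. apply typed_Arr. Qed.

Lemma typed_ac (X Y : C) : typed (ac X Y) (X ⊕ Y) (Y ⊕ X).
Proof. apply typed_Arr. Qed.

(** Computes the ends of an arrow from its shape and leaves to [ob] the matching of ends in
    composites; [ty] and [ok] derive a prescribed typing and definedness from it. *)
Ltac synth :=
  lazymatch goal with
  | |- typed (_ • _) _ _ => eapply typed_acomp; [synth | synth | ob]
  | |- typed (alift _ _ _) _ _ => eapply typed_alift; synth
  | |- typed (ident _) _ _ => apply typed_ident
  | |- typed (dl _ _ _) _ _ => apply typed_dl
  | |- typed (ac _ _) _ _ => apply typed_ac
  | |- typed (hba _ _) _ _ => apply typed_hba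
  | |- typed (Arr _) _ _ => apply typed_Arr
  | _ => match goal with
         | h : typed ?f _ _ |- typed ?f _ _ => apply h
         | h : forall x, typed (?f x) _ _ |- typed (?f _) _ _ => apply h
         end
  end.

Ltac ty := eapply typed_conv; [synth | ob | ob].
Ltac ok := eapply typed_defined; synth.

Lemma comp_identl (X : C) (f : arrow) (Y : C) : typed f Y X -> ι X • f = f.
Proof. intros t; apply ident_l; ok. Qed.

Lemma comp_identr (X : C) (f : arrow) (Y : C) : typed f X Y -> f • ι X = f.
Proof. intros t; apply ident_r; ok. Qed.

(** Naturality of a constraint that is an identity is strictness on arrows. The analogues below hold
    for the same reason. *)
Lemma ar_addA (f g h : arrow) : f ⊞ (g ⊞ h) = f ⊞ g ⊞ h.
Proof.
destruct f as [|X X' f], g as [|Y Y' g], h as [|Z Z' h]; trivial.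
assert (e := f_equal (@Arr C _ _) (assoc_nat (add A) f g h)).
rewrite Arr_identity_l in e by apply (strict_addA hA).
now rewrite Arr_identity_r in e by apply (strict_addA hA).
Qed.

Lemma ar_mulA (f g h : arrow) : f ⊠ (g ⊠ h) = f ⊠ g ⊠ h.
Proof.
destruct f as [|X X' f], g as [|Y Y' g], h as [|Z Z' h]; trivial.
assert (e := f_equal (@Arr C _ _) (assoc_nat (mul A) f g h)).
rewrite Arr_identity_l in e by apply (strict_mulA hA).
now rewrite Arr_identity_r in e by apply (strict_mulA hA).
Qed.

Lemma ar_addl (f : arrow) : ι O ⊞ f = f.
Proof.
destruct f as [|X Y f]; trivial.
assert (e := f_equal (@Arr C _ _) (lunit_nat (add A) f)).
rewrite Arr_identity_l in e by apply (strict_addl hA).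
now rewrite Arr_identity_r in e by apply (strict_addl hA).
Qed.

Lemma ar_addr (f : arrow) : f ⊞ ι O = f.
Proof.
destruct f as [|X Y f]; trivial.
assert (e := f_equal (@Arr C _ _) (runit_nat (add A) f)).
rewrite Arr_identity_l in e by apply (strict_addr hA).
now rewrite Arr_identity_r in e by apply (strict_addr hA).
Qed.

Lemma ar_mull (f : arrow) : ι I ⊠ f = f.
Proof.
destruct f as [|X Y f]; trivial.
assert (e := f_equal (@Arr C _ _) (lunit_nat (mul A) f)).
rewrite Arr_identity_l in e by apply (strict_mull hA).
now rewrite Arr_identity_r in e by apply (strict_mull hA).
Qed.

Lemma ar_mulr (f : arrow) : f ⊠ ι I = f.
Proof.
destruct f as [|X Y f]; trivial.
assert (e := f_equal (@Arr C _ _) (runit_nat (mul A) f)).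
rewrite Arr_identity_l in e by apply (strict_mulr hA).
now rewrite Arr_identity_r in e by apply (strict_mulr hA).
Qed.

Lemma ar_distR (f g h : arrow) : (f ⊞ g) ⊠ h = f ⊠ h ⊞ g ⊠ h.
Proof.
destruct f as [|X X' f], g as [|Y Y' g], h as [|Z Z' h]; trivial.
assert (e := f_equal (@Arr C _ _) (distR_nat (ann_ax A) f g h)).
rewrite Arr_identity_l in e by apply (strict_distR hA).
now rewrite Arr_identity_r in e by apply (strict_distR hA).
Qed.

Lemma Arr_alift (F : bifunctor C) (X X' Y Y' : C) (f : hom X X')
    (g : hom Y Y') :
  Arr (bi_hom F f g) = alift F (Arr f) (Arr g).
Proof. reflexivity. Qed.

Lemma Arr_idm (X : C) : Arr (idm X) = ι X.
Proof. reflexivity. Qed.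

Lemma Arr_addA (X Y Z : C) : Arr (addA A X Y Z) = ι (X ⊕ Y ⊕ Z).
Proof.
now rewrite (proj2 (identity_Arr (strict_addA hA X Y Z))), ob_addA.
Qed.

Lemma Arr_addAV (X Y Z : C) : Arr (iso_inv (addA A X Y Z)) = ι (X ⊕ Y ⊕ Z).
Proof. apply identity_Arr, identity_inv, strict_addA, hA. Qed.

Lemma Arr_mulA (X Y Z : C) : Arr (mulA A X Y Z) = ι (X ⊗ Y ⊗ Z).
Proof.
now rewrite (proj2 (identity_Arr (strict_mulA hA X Y Z))), ob_mulA.
Qed.

Lemma Arr_mulAV (X Y Z : C) : Arr (iso_inv (mulA A X Y Z)) = ι (X ⊗ Y ⊗ Z).
Proof. apply identity_Arr, identity_inv, strict_mulA, hA. Qed.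

Lemma Arr_addl (X : C) : Arr (addl A X) = ι X.
Proof.
now rewrite (proj2 (identity_Arr (strict_addl hA X))), ob_addl.
Qed.

Lemma Arr_addr (X : C) : Arr (addr A X) = ι X.
Proof.
now rewrite (proj2 (identity_Arr (strict_addr hA X))), ob_addr.
Qed.

Lemma Arr_mull (X : C) : Arr (mull A X) = ι X.
Proof.
now rewrite (proj2 (identity_Arr (strict_mull hA X))), ob_mull.
Qed.

Lemma Arr_mulr (X : C) : Arr (mulr A X) = ι X.
Proof.
now rewrite (proj2 (identity_Arr (strict_mulr hA X))), ob_mulr.
Qed.

Lemma Arr_distR (X Y Z : C) : Arr (distR A X Y Z) = ι (X ⊗ Z ⊕ Y ⊗ Z).
Proof.
now rewrite (proj2 (identity_Arr (strict_distR hA X Y Z))), ob_distR.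
Qed.

Lemma Arr_distL (X Y Z : C) : Arr (distL A X Y Z) = dl X Y Z.
Proof. reflexivity. Qed.

Lemma Arr_addC (X Y : C) : Arr (addC A X Y) = ac X Y.
Proof. reflexivity. Qed.

(** Transfers an equation of [C] to untyped arrows and erases the strict constraints, which have
    become identities. *)
Ltac push e :=
  apply (f_equal (@Arr C _ _)) in e;
  rewrite ?Arr_comp, ?Arr_alift, ?Arr_idm, ?Arr_addA, ?Arr_addAV, ?Arr_mulA,
    ?Arr_mulAV, ?Arr_addl, ?Arr_addr, ?Arr_mull, ?Arr_mulr, ?Arr_distR,
    ?Arr_distL, ?Arr_addC, ?alift_ident in e;
  repeat first [rewrite ident_l in e by ok | rewrite ident_r in e by ok].

Ltac push_goal :=
  apply Arr_inj;
  rewrite ?Arr_comp, ?Arr_alift, ?Arr_idm, ?Arr_addA, ?Arr_addAV, ?Arr_mulA,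
    ?Arr_mulAV, ?Arr_addl, ?Arr_addr, ?Arr_mull, ?Arr_mulr, ?Arr_distR,
    ?Arr_distL, ?Arr_addC, ?alift_ident;
  repeat first [rewrite ident_l by ok | rewrite ident_r by ok].

(** * Axioms for L and c^+ on untyped arrows *)

Lemma dl_nat (f g h : arrow) (X X' Y Y' Z Z' : C) :
  typed f X X' -> typed g Y Y' -> typed h Z Z' ->
  dl X' Y' Z' • f ⊠ (g ⊞ h) = (f ⊠ g ⊞ f ⊠ h) • dl X Y Z.
Proof.
intros [f' ->] [g' ->] [h' ->].
assert (e := f_equal (@Arr C _ _) (distL_nat (ann_ax A) f' g' h')).
now rewrite !Arr_comp in e.
Qed.

Lemma ac_nat (f g : arrow) (X X' Y Y' : C) :
  typed f X X' -> typed g Y Y' -> ac X' Y' • f ⊞ g = g ⊞ f • ac X Y.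
Proof.
intros [f' ->] [g' ->].
assert (e := f_equal (@Arr C _ _)
  (braiding_nat (symmetry_braiding (scg_symmetry (add_scg A))) f' g')).
now rewrite !Arr_comp in e.
Qed.

Lemma acK (X Y : C) : ac Y X • ac X Y = ι (X ⊕ Y).
Proof.
unfold ac; now rewrite <- Arr_comp, (symmetry_invol (scg_symmetry (add_scg A))).
Qed.

Lemma dl_addA (X Y Z T : C) :
  dl X Y Z ⊞ ι (X ⊗ T) • dl X (Y ⊕ Z) T
  = ι (X ⊗ Y) ⊞ dl X Z T • dl X Y (Z ⊕ T).
Proof. assert (e := ann1_La (ann_ax A) X Y Z T); push e; exact e. Qed.

Lemma dl_addC (X Y Z : C) :
  ac (X ⊗ Y) (X ⊗ Z) • dl X Y Z = dl X Z Y • ι X ⊠ ac Y Z.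
Proof. assert (e := ann1_Lc (ann_ax A) X Y Z); push e; exact e. Qed.

Lemma ac_distR (X Y Z : C) : ac (X ⊗ Z) (Y ⊗ Z) = ac X Y ⊠ ι Z.
Proof. assert (e := ann1_Rc (ann_ax A) X Y Z); push e; exact e. Qed.

Lemma dl_mulA (X Y Z T : C) :
  dl (X ⊗ Y) Z T = dl X (Y ⊗ Z) (Y ⊗ T) • ι X ⊠ dl Y Z T.
Proof. assert (e := ann2_1 (ann_ax A) X Y Z T); push e; exact e. Qed.

Lemma dl_mulr (X Y Z T : C) : dl X Y Z ⊠ ι T = dl X (Y ⊗ T) (Z ⊗ T).
Proof. assert (e := ann2_3 (ann_ax A) X Y Z T); push e; exact e. Qed.

(** The interchange v of (Ann-2)(4), in which only c^+ survives because a^+ is an identity. *)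
Definition inter (X Y Z T : C) : arrow := ι X ⊞ ac Y Z ⊞ ι T.

Lemma dl_inter (X Y Z T : C) :
  inter (X ⊗ Z) (Y ⊗ Z) (X ⊗ T) (Y ⊗ T) • dl (X ⊕ Y) Z T
  = dl X Z T ⊞ dl Y Z T.
Proof.
assert (e := ann2_4 (ann_ax A) X Y Z T); unfold interchange in e; push e.
exact e.
Qed.

Lemma dl_one (X Y : C) : dl I X Y = ι (X ⊕ Y).
Proof. assert (e := ann3_L (ann_ax A) X Y); push e; exact e. Qed.

(** * Cancellation *)

Lemma ar_inv (f : arrow) (X Y : C) : typed f X Y ->
  exists g, typed g Y X /\ g • f = ι X /\ f • g = ι Y.
Proof.
intros [f' ->]; destruct (scg_groupoid (add_scg A) f') as (g & e & e').
exists (Arr g); split; [apply typed_Arr|].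
now rewrite <- !Arr_comp, e, e'.
Qed.

Lemma acompI (f g h : arrow) (X Y Z : C) :
  typed f Y Z -> typed g X Y -> typed h X Y -> f • g = f • h -> g = h.
Proof.
intros tf tg th e; destruct (ar_inv tf) as (k & tk & e1 & _).
rewrite <- (comp_identl tg), <- (comp_identl th), <- e1, <- !acompA.
now rewrite e.
Qed.

Lemma acompIr (f g h : arrow) (X Y Z : C) :
  typed f X Y -> typed g Y Z -> typed h Y Z -> g • f = h • f -> g = h.
Proof.
intros tf tg th e; destruct (ar_inv tf) as (k & tk & _ & e1).
rewrite <- (comp_identr tg), <- (comp_identr th), <- e1, !acompA.
now rewrite e.
Qed.

(** Adding the identity of an opposite of [X] on the left turns [ι X] into [ι O], a strict unit. *)
Lemma addI (X : C) (f g : arrow) : ι X ⊞ f = ι X ⊞ g -> f = g.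
Proof.
intros e; destruct (ob_opp X) as (X' & _ & eX).
now rewrite <- (ar_addl f), <- (ar_addl g), <- eX, <- alift_ident, <- !ar_addA,
  e.
Qed.

Lemma addIr (X : C) (f g : arrow) : f ⊞ ι X = g ⊞ ι X -> f = g.
Proof.
intros e; destruct (ob_opp X) as (X' & eX & _).
now rewrite <- (ar_addr f), <- (ar_addr g), <- eX, <- alift_ident, !ar_addA, e.
Qed.

Lemma lift_lr (F : bifunctor C) (f g : arrow) (X X' Y Y' : C) :
  typed f X X' -> typed g Y Y' ->
  alift F f g = alift F f (ι Y') • alift F (ι X) g.
Proof.
intros tf tg; rewrite <- alift_acomp by ok.
now rewrite (comp_identr tf), (comp_identl tg).
Qed.

Lemma lift_rl (F : bifunctor C) (f g : arrow) (X X' Y Y' : C) :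
  typed f X X' -> typed g Y Y' ->
  alift F f g = alift F (ι X') g • alift F f (ι Y).
Proof.
intros tf tg; rewrite <- alift_acomp by ok.
now rewrite (comp_identl tf), (comp_identr tg).
Qed.

Lemma add_cancel (f g h : arrow) (X X' Y Y' : C) :
  typed f X X' -> typed g Y Y' -> typed h Y Y' -> f ⊞ g = f ⊞ h -> g = h.
Proof.
intros tf tg th; rewrite (lift_lr _ tf tg), (lift_lr _ tf th).
intros e; apply acompI with (X := X ⊕ Y) (Y := X ⊕ Y') (Z := X' ⊕ Y') in e;
  try ty.
exact (addI e).
Qed.

Lemma add_divide (f g : arrow) (X X' Y Y' : C) :
  typed f X X' -> typed g (X ⊕ Y) (X' ⊕ Y') ->
  exists h, typed h Y Y' /\ f ⊞ h = g.
Proof.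
intros tf tg.
destruct (ob_opp X) as (X1 & e & e').
destruct (ar_inv tf) as (f' & tf' & ef & ef').
(* Composing with the inverse of [f] turns the equation into [ι X ⊞ h = (f' ⊞ ι Y') • g]; adding
   [ι X1] on the left then isolates [h]. *)
exists (ι X1 ⊞ (f' ⊞ ι Y' • g)).
assert (t : typed (ι X1 ⊞ (f' ⊞ ι Y' • g)) Y Y').
{ eapply typed_conv; [synth | |]; now rewrite ob_addA, e', ob_addl. }
split; trivial.
rewrite (lift_lr _ tf t), ar_addA, alift_ident, e, ar_addl, acompA.
rewrite <- alift_acompr, ef', alift_ident by ok.
apply ident_l; ok.
Qed.

Lemma inter_nat (f g h k : arrow) (X X' Y Y' Z Z' T T' : C) :
  typed f X X' -> typed g Y Y' -> typed h Z Z' -> typed k T T' ->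
  inter X' Y' Z' T' • (f ⊞ g ⊞ (h ⊞ k)) = (f ⊞ h ⊞ (g ⊞ k)) • inter X Y Z T.
Proof.
intros tf tg th tk; unfold inter.
rewrite !ar_addA, <- (ar_addA f g h), <- (ar_addA f h g).
rewrite <- !alift_acomp by ok.
now rewrite (comp_identl tf), (comp_identr tf), (comp_identl tk),
  (comp_identr tk), (ac_nat tg th).
Qed.

Lemma interK (X Y Z T : C) :
  inter X Z Y T • inter X Y Z T = ι (X ⊕ Y ⊕ Z ⊕ T).
Proof.
unfold inter; rewrite <- !alift_acomp by ok.
rewrite acK, !ident_l by ok.
now rewrite !alift_ident, ob_addA.
Qed.

(** * Half-braidings on a sum *)

(* The axioms of the center, in the order: naturality, (C1), (C2), (C3); [lhs] and
   [rhs] are their two sides. *)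
Inductive law : Type :=
| Law_nat (X Y : C) (f : hom X Y)
| Law_one
| Law_mul (X Y : C)
| Law_add (X Y : C).

Definition lsrc (i : law) : C :=
  match i with
  | @Law_nat X Y f => X | Law_one => I
  | Law_mul X Y => X ⊗ Y | Law_add X Y => X ⊕ Y
  end.

Definition ltgt (i : law) : C :=
  match i with
  | @Law_nat X Y f => Y | Law_one => I
  | Law_mul X Y => X ⊗ Y | Law_add X Y => X ⊕ Y
  end.

Definition lhs (U : C) (m : C -> arrow) (i : law) : arrow :=
  match i with
  | @Law_nat X Y f => m Y • ι U ⊠ Arr f
  | Law_one => m I
  | Law_mul X Y => m (X ⊗ Y)
  | Law_add X Y => m (X ⊕ Y)
  end.

Definition rhs (U : C) (m : C -> arrow) (i : law) : arrow :=
  match i with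
  | @Law_nat X Y f => Arr f ⊠ ι U • m X
  | Law_one => ι U
  | Law_mul X Y => ι X ⊠ m Y • m X ⊠ ι Y
  | Law_add X Y => (m X ⊞ m Y) • dl U X Y
  end.

Definition hb_typed (U : C) (m : C -> arrow) : Prop :=
  forall X, typed (m X) (U ⊗ X) (X ⊗ U).

Lemma typed_lhs (U : C) (m : C -> arrow) (i : law) :
  hb_typed U m -> typed (lhs U m i) (U ⊗ lsrc i) (ltgt i ⊗ U).
Proof. intros t; red in t; destruct i; simpl; ty. Qed.

Lemma typed_rhs (U : C) (m : C -> arrow) (i : law) :
  hb_typed U m -> typed (rhs U m i) (U ⊗ lsrc i) (ltgt i ⊗ U).
Proof. intros t; red in t; destruct i; simpl; ty. Qed.

Definition sum_rel (U V : C) (m n w : C -> arrow) : Prop :=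
  forall X, dl X U V • w X = m X ⊞ n X.

Lemma lhs_sum (U V : C) (m n w : C -> arrow) (i : law) :
  hb_typed U m -> hb_typed V n -> hb_typed (U ⊕ V) w -> sum_rel U V m n w ->
  dl (ltgt i) U V • lhs (U ⊕ V) w i = lhs U m i ⊞ lhs V n i.
Proof.
intros tm tn tw e; red in tm, tn, tw, e; destruct i as [X Y f| |X Y|X Y]; simpl;
  try apply e.
now rewrite acompA, e, <- alift_ident, ar_distR, alift_acomp by ok.
Qed.

Lemma rhs_sum (U V : C) (m n w : C -> arrow) (i : law) :
  hb_typed U m -> hb_typed V n -> hb_typed (U ⊕ V) w -> sum_rel U V m n w ->
  dl (ltgt i) U V • rhs (U ⊕ V) w i = rhs U m i ⊞ rhs V n i.
Proof.
intros tm tn tw e; red in tm, tn, tw, e; destruct i as [X Y f| |X Y|X Y]; simpl.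
- rewrite acompA, <- alift_ident.
  rewrite (dl_nat (typed_Arr f) (typed_ident U) (typed_ident V)).
  now rewrite <- acompA, e, alift_acomp by ok.
- rewrite dl_one, alift_ident; apply ident_l; ok.
(* (C2): (Ann-2)(1) splits L at [X ⊗ Y]. The inner L meets [w Y]; the outer one, moved past [m Y]
   and [n Y] by naturality, is L at [X] times [ι Y] by (Ann-2)(3) and meets [w X]. *)
- rewrite dl_mulA, <- acompA, (acompA (ι X ⊠ dl _ _ _)).
  rewrite <- alift_acompl by ok.
  rewrite e, acompA.
  rewrite (dl_nat (typed_ident X) (tm Y) (tn Y)).
  rewrite <- !acompA, <- dl_mulr, <- alift_acompr by ok.
  now rewrite e, ar_distR, alift_acomp by ok.
(* (C3): (Ann-2)(4) is used for [X ⊕ Y] at the target and for [U ⊕ V] at the source. The two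
   interchanges that arise at the source are mutually inverse. *)
- apply acompI with (f := inter (X ⊗ U) (Y ⊗ U) (X ⊗ V) (Y ⊗ V))
    (X := (U ⊕ V) ⊗ (X ⊕ Y)) (Y := X ⊗ U ⊕ Y ⊗ U ⊕ X ⊗ V ⊕ Y ⊗ V)
    (Z := X ⊗ U ⊕ X ⊗ V ⊕ Y ⊗ U ⊕ Y ⊗ V); try (unfold inter; ty).
  rewrite !acompA, dl_inter, <- alift_acomp, !e by ok.
  rewrite alift_acomp, acompA by ok.
  rewrite (inter_nat (tm X) (tm Y) (tn X) (tn Y)).
  rewrite <- dl_inter, <- !acompA, (acompA (inter _ _ _ _)), interK.
  now rewrite ident_l by ok.
Qed.

Definition central (U : C) (m : C -> arrow) : Prop :=
  hb_typed U m /\ forall i, lhs U m i = rhs U m i.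

Lemma central_sum (U V : C) (m n w : C -> arrow) :
  central U m -> central V n -> hb_typed (U ⊕ V) w -> sum_rel U V m n w ->
  central (U ⊕ V) w.
Proof.
intros [tm cm] [tn cn] tw e; split; trivial; intros i.
apply acompI with (f := dl (ltgt i) U V) (X := (U ⊕ V) ⊗ lsrc i)
  (Y := ltgt i ⊗ (U ⊕ V)) (Z := ltgt i ⊗ U ⊕ ltgt i ⊗ V);
  auto using typed_dl, typed_lhs, typed_rhs.
now rewrite (lhs_sum _ tm tn tw e), (rhs_sum _ tm tn tw e), cm, cn.
Qed.

Lemma central_difference (U V : C) (m n w : C -> arrow) :
  central U m -> central (U ⊕ V) w -> hb_typed V n -> sum_rel U V m n w ->
  central V n.
Proof.
intros [tm cm] [tw cw] tn e; split; trivial; intros i.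
apply (add_cancel (typed_lhs i tm) (typed_lhs i tn) (typed_rhs i tn)).
(* Now both sides are sums to which [lhs_sum] and [rhs_sum] apply. *)
rewrite cm at 2.
now rewrite <- (lhs_sum _ tm tn tw e), <- (rhs_sum _ tm tn tw e), cw.
Qed.

(** * The half-braiding on zero *)

(* As [p] starts at [0], [p ⊕ p = (p ⊕ id) p], whence [p] is determined by [L]. *)
Lemma zero_add (X : C) (p : arrow) : typed p O (X ⊗ O) ->
  dl X O O • p = p ⊞ p -> p ⊞ ι (X ⊗ O) = dl X O O.
Proof.
intros tp e; rewrite (lift_lr _ tp tp), ar_addl in e.
symmetry; apply (acompIr tp (Z := X ⊗ O ⊕ X ⊗ O)) in e; trivial; ty.
Qed.

Lemma zero_unique (X : C) (p q : arrow) :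
  typed p O (X ⊗ O) -> typed q O (X ⊗ O) ->
  dl X O O • p = p ⊞ p -> dl X O O • q = q ⊞ q -> p = q.
Proof.
intros tp tq ep eq; apply (addIr (X := X ⊗ O)).
now rewrite (zero_add tp ep), (zero_add tq eq).
Qed.

Lemma zero_exists (X : C) :
  exists p, typed p (O ⊗ X) (X ⊗ O) /\ dl X O O • p = p ⊞ p.
Proof.
destruct (ob_opp (X ⊗ O)) as (Y & e & e').
assert (t : typed (dl X O O ⊞ ι Y) O (X ⊗ O)).
{ eapply typed_conv; [synth | | ].
  - now rewrite ob_addl, e.
  - now rewrite <- ob_addA, e, ob_addr. }
(* By [zero_add], a solution satisfies [p ⊞ ι (X ⊗ O) = dl X O O]; adding the identity of the
   opposite [Y] of [X ⊗ O] on the right determines [p]. *)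
exists (dl X O O ⊞ ι Y); split; [now rewrite ob_mul0|].
rewrite (lift_lr _ t t), ar_addl, <- ar_addA, alift_ident, e'.
now rewrite ar_addr.
Qed.

(* By the hexagon, [c_{0,0}] is idempotent. *)
Lemma ac_zero : ac O O = ι O.
Proof.
assert (e := hexagon1 (symmetry_braiding (scg_symmetry (add_scg A))) O O O).
push e; fold (zero A) in e; rewrite ar_addl, ar_addr, ob_addl in e.
apply (acompI (typed_ac O O) (X := O ⊕ O)); [ty | ty |].
rewrite e; now rewrite ident_r by ok.
Qed.

(* By (Ann-2)(4), [L_{0,0,0}] is idempotent. *)
Lemma dl_zero : dl O O O = ι O.
Proof.
assert (e := dl_inter O O O O); unfold inter in e.
rewrite !ob_mul0, ar_addl, ar_addr, ac_zero, ob_addl in e.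
rewrite ident_l in e by ok.
assert (t : typed (dl O O O) O O) by ty.
rewrite (lift_lr _ t t), ar_addl, ar_addr in e.
apply (acompI t (X := O)); [ty | ty |].
now rewrite <- e, (comp_identr t).
Qed.

Section Zero.

Variable u : C -> arrow.
Hypothesis tu : hb_typed O u.
Hypothesis eu : forall X, dl X O O • u X = u X ⊞ u X.

Lemma typed_zero (X : C) : typed (u X) O (X ⊗ O).
Proof. rewrite <- (ob_mul0 X) at 1; apply tu. Qed.

(** Since [O ⊕ O = O], the family [u] is the sum of two copies of itself. Hence both sides of each
    axiom solve the equation of [zero_unique]. *)
Lemma zero_central : central O u.
Proof.
split; trivial; intros i.
assert (tu' : hb_typed (O ⊕ O) u) by now rewrite ob_addl.
assert (l := lhs_sum i tu tu tu' eu).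
assert (r := rhs_sum i tu tu tu' eu).
assert (tl := typed_lhs i tu).
assert (tr := typed_rhs i tu).
rewrite ob_addl in l, r; rewrite ob_mul0 in tl, tr.
exact (zero_unique tl tr l r).
Qed.

(** After cancelling one L, compatibility with a^+ at three zeros reads [L ⊕ id = id ⊕ L], which
    moves [u X] from the left summand to the right one. *)
Lemma zero_addr_dl (X : C) : ι (X ⊗ O) ⊞ u X = dl X O O.
Proof.
apply (addIr (X := X ⊗ O)).
rewrite <- ar_addA.
rewrite (zero_add (typed_zero X) (eu X)).
assert (e := dl_addA X O O O); rewrite ob_addl in e.
now apply (acompIr (typed_dl X O O) (Z := X ⊗ O ⊕ X ⊗ O ⊕ X ⊗ O)) in e;
  [|ty|ty].
Qed.

(** This formula and [zero_addr] make [(O, u)] a strict unit for the sum of half-braidings. *)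
Lemma zero_addl (X Y : C) : u X ⊞ ι (X ⊗ Y) = dl X O Y.
Proof.
apply (addI (X := X ⊗ O)); rewrite ar_addA, zero_addr_dl.
assert (e := dl_addA X O O Y); rewrite !ob_addl in e.
now apply (acompIr (typed_dl X O Y) (Z := X ⊗ O ⊕ X ⊗ O ⊕ X ⊗ Y)) in e;
  [|ty|ty].
Qed.

Lemma zero_addr (X Y : C) : ι (X ⊗ Y) ⊞ u X = dl X Y O.
Proof.
apply (addIr (X := X ⊗ O)); rewrite <- ar_addA.
rewrite (zero_add (typed_zero X) (eu X)).
assert (e := dl_addA X Y O O); rewrite !ob_addr in e.
now apply (acompIr (typed_dl X Y O) (Z := X ⊗ Y ⊕ X ⊗ O ⊕ X ⊗ O)) in e;
  [|ty|ty].
Qed.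

(** By [dl_zero], the identity of [O] solves the equation that determines [u O]. This yields the
    axiom on c_{0,0}. *)
Lemma zero_zero : u O = ι O.
Proof.
assert (t := typed_zero O); rewrite ob_mul0 in t.
apply (zero_unique (X := O)); trivial;
  try (rewrite ob_mul0; ty); try apply typed_zero.
rewrite dl_zero, ar_addl; apply ident_l; ok.
Qed.

End Zero.

(** * Half-braidings on a product *)

Lemma central_prod (U V : C) (m n w : C -> arrow) :
  central U m -> central V n -> hb_typed (U ⊗ V) w ->
  (forall X, w X = m X ⊠ ι V • ι U ⊠ n X) -> central (U ⊗ V) w.
Proof.
intros [tm em] [tn en] tw ew; split; trivial; red in tm, tn.
intros [X Y f| |X Y|X Y]; simpl; rewrite !ew.
- assert (e := em (Law_nat f)); assert (e' := en (Law_nat f)); simpl in e, e'.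
  rewrite <- acompA, <- (alift_ident _ U V), <- ar_mulA, <- alift_acompl, e'
    by ok.
  rewrite alift_acompl, acompA, (ar_mulA _ _ (ι V)), <- alift_acompr, e by ok.
  now rewrite alift_acompr, <- ar_mulA, alift_ident, acompA by ok.
- assert (e := em Law_one); assert (e' := en Law_one); simpl in e, e'.
  rewrite e, e', alift_ident; apply ident_l; ok.
- assert (e := em (Law_mul X Y)); assert (e' := en (Law_mul X Y));
    simpl in e, e'.
  rewrite e, e', !alift_acompl, !alift_acompr, !ar_mulA, !acompA by ok.
  (* [m X] and [n Y] act on disjoint factors, so they commute. *)
  assert (x : m X ⊠ ι Y ⊠ ι V • ι U ⊠ ι X ⊠ n Y
    = ι X ⊠ ι U ⊠ n Y • m X ⊠ ι V ⊠ ι Y).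
  { rewrite <- !(ar_mulA (m X)), !alift_ident.
    now rewrite <- (lift_lr _ (tm X) (tn Y)), <- (lift_rl _ (tm X) (tn Y)). }
  now rewrite <- (acompA _ (m X ⊠ ι Y ⊠ ι V)), x, acompA.
- assert (e := em (Law_add X Y)); assert (e' := en (Law_add X Y));
    simpl in e, e'.
  rewrite e, e', !alift_acompl, !alift_acompr by ok.
  rewrite dl_mulr, dl_mulA, alift_acomp, ar_distR, !acompA by ok.
  f_equal; rewrite <- !acompA; f_equal.
  apply (dl_nat (typed_ident U) (tn X) (tn Y)).
Qed.



(** * Objects and morphisms of the center in terms of untyped arrows *)

Lemma hba_typed (U : half_braided A) : hb_typed U (hba U).
Proof. intros X; apply typed_Arr. Qed.

Lemma central_is_central (U : half_braided A) :
  central U (hba U) -> is_central U.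
Proof.
intros [_ c]; split; intros.
- push_goal; rewrite ?Arr_hb; exact (c (Law_nat f)).
- push_goal; rewrite ?Arr_hb; exact (c Law_one).
- push_goal; rewrite ?Arr_hb; exact (c (Law_mul X Y)).
- push_goal; rewrite ?Arr_hb; exact (c (Law_add X Y)).
Qed.

Lemma is_central_central (U : half_braided A) :
  is_central U -> central U (hba U).
Proof.
intros c; split; [apply hba_typed|]; intros [X Y f| |X Y|X Y]; simpl.
- assert (e := hb_nat c f); push e; exact e.
- assert (e := hb_one c); push e; exact e.
- assert (e := hb_mul c X Y); push e; exact e.
- assert (e := hb_add c X Y); push e; exact e.
Qed.

Lemma center_homP (U V : half_braided A) (f : hom U V) :
  is_center_hom f <->
  forall X, hba V X • Arr f ⊠ ι X = ι X ⊠ Arr f • hba U X.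
Proof.
split; intros h X; specialize (h X).
- push h; exact h.
- push_goal; exact h.
Qed.

Lemma hba_sum (U V : half_braided A) (X : C) :
  dl X U V • hba (half_add U V) X = hba U X ⊞ hba V X.
Proof.
unfold hba, half_add; simpl; rewrite !Arr_comp, Arr_distR.
rewrite ident_r, acompA by ok.
unfold dl; rewrite <- Arr_comp, isoVK; apply ident_l; ok.
Qed.

Lemma hba_prod (U V : half_braided A) (X : C) :
  hba (half_mul U V) X = hba U X ⊠ ι V • ι U ⊠ hba V X.
Proof.
unfold hba at 1, half_mul; simpl.
rewrite ?Arr_comp, ?Arr_alift, ?Arr_idm, ?Arr_mulA, ?Arr_mulAV.
now repeat first [rewrite ident_l by ok | rewrite ident_r by ok].
Qed.

Lemma half_add_central (U V : center_ob A) : is_central (half_add U V).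
Proof.
apply central_is_central, (central_sum (is_central_central (half_central U))
  (is_central_central (half_central V))).
- apply (hba_typed (half_add U V)).
- intros X; apply hba_sum.
Qed.

Lemma half_mul_central (U V : center_ob A) : is_central (half_mul U V).
Proof.
apply central_is_central, (central_prod (is_central_central (half_central U))
  (is_central_central (half_central V))).
- apply (hba_typed (half_mul U V)).
- intros X; apply hba_prod.
Qed.

Lemma hba_nat (U : center_ob A) (f : arrow) (X Y : C) : typed f X Y ->
  hba U Y • ι U ⊠ f = f ⊠ ι U • hba U X.
Proof.
intros [f' ->].
exact (proj2 (is_central_central (half_central U)) (Law_nat f')).
Qed.

Lemma hba_mul (U : center_ob A) (X Y : C) :
  hba U (X ⊗ Y) = ι X ⊠ hba U Y • hba U X ⊠ ι Y.
Proof. exact (proj2 (is_central_central (half_central U)) (Law_mul X Y)). Qed.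

Lemma sum_eq (U V : half_braided A) (X Y : C) (f g : arrow) :
  typed f Y (X ⊗ (U ⊕ V)) -> typed g Y (X ⊗ (U ⊕ V)) ->
  dl X U V • f = dl X U V • g -> f = g.
Proof. intros tf tg; exact (acompI (typed_dl X U V) tf tg). Qed.

(** * Constraints as arrows of the center *)

Lemma center_hom_add (U U' V V' : half_braided A) (f : hom U U')
    (g : hom V V') :
  is_center_hom f -> is_center_hom g ->
  @is_center_hom C A (half_add U V) (half_add U' V') (bi_hom (add A) f g).
Proof.
rewrite !center_homP; intros hf hg X.
change (Arr (bi_hom (add A) f g)) with (Arr f ⊞ Arr g).
change (carrier (half_add U V)) with (U ⊕ V).
apply sum_eq with (X := X) (U := U') (V := V') (Y := (U ⊕ V) ⊗ X); try ty.
rewrite acompA, hba_sum, ar_distR, <- alift_acomp, hf, hg by ok.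
rewrite acompA, (dl_nat (typed_ident X) (typed_Arr f) (typed_Arr g)), <- acompA.
now rewrite hba_sum, alift_acomp by ok.
Qed.

Lemma center_hom_mul (U U' V V' : half_braided A) (f : hom U U')
    (g : hom V V') :
  is_center_hom f -> is_center_hom g ->
  @is_center_hom C A (half_mul U V) (half_mul U' V') (bi_hom (mul A) f g).
Proof.
rewrite !center_homP; intros hf hg X.
change (Arr (bi_hom (mul A) f g)) with (Arr f ⊠ Arr g).
rewrite !hba_prod.
assert (t : typed (ι X ⊠ Arr g • hba V X) (V ⊗ X) (X ⊗ V')) by ty.
rewrite <- acompA, <- ar_mulA, <- alift_acomp, hg, ident_l by ok.
rewrite (lift_lr _ (typed_Arr f) t), <- (alift_ident _ X V'), ar_mulA, acompA.
rewrite <- alift_acompr, hf, alift_acompr, alift_acompl by ok.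
rewrite ar_mulA, alift_ident, acompA, <- (acompA _ (hba U X ⊠ ι V')).
rewrite <- (lift_lr _ (typed_hba U X) (typed_Arr g)).
rewrite (lift_rl _ (typed_hba U X) (typed_Arr g)), !acompA.
rewrite <- alift_acomp by ok.
now rewrite ident_r, ident_l, ar_mulA by ok.
Qed.

Lemma center_hom_inv (U V : half_braided A) (f : iso (carrier U) (carrier V)) :
  is_center_hom f -> @is_center_hom C A V U (iso_inv f).
Proof.
rewrite !center_homP; intros h X; specialize (h X).
assert (k : Arr (iso_inv f) • Arr f = ι U) by now rewrite <- Arr_comp, isoK.
assert (k' : Arr f • Arr (iso_inv f) = ι V) by now rewrite <- Arr_comp, isoVK.
apply acompIr with (f := Arr f ⊠ ι X) (X := U ⊗ X) (Y := V ⊗ X) (Z := X ⊗ U);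
  try ty.
rewrite <- !acompA, h, <- alift_acompr, k, alift_ident, ident_r by ok.
now rewrite acompA, <- alift_acompl, k, alift_ident, ident_l by ok.
Qed.

(** For a strict constraint, being a morphism of the center amounts to equality of the
    half-braidings at its ends, compared as untyped arrows. *)
Lemma center_hom_identity (U V : half_braided A) (f : hom U V) :
  Arr f = ι U -> (forall X, hba U X = hba V X) -> is_center_hom f.
Proof.
intros e h; apply center_homP; intros X.
assert (t := typed_Arr f); rewrite e in t.
rewrite e, <- h, !alift_ident, ident_l, ident_r; trivial.
- ok.
- eapply typed_defined, typed_acomp; [synth | synth | reflexivity].
Qed.

Lemma center_hom_addA (U V W : half_braided A) :
  @is_center_hom C A (half_add U (half_add V W)) (half_add (half_add U V) W)
    (addA A U V W).
Proof.
apply center_hom_identity.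
- simpl; now rewrite Arr_addA, ?ob_addA.
- intros X.
  (* The iterated L, expanded in either of the two ways of (Ann-1), sends both half-braidings to the
     direct sum of the three given ones. *)
  apply acompI with (f := dl X U V ⊞ ι (X ⊗ W) • dl X (U ⊕ V) W)
    (X := (U ⊕ V ⊕ W) ⊗ X) (Y := X ⊗ (U ⊕ V ⊕ W)) (Z := X ⊗ U ⊕ X ⊗ V ⊕ X ⊗ W);
    try (simpl; ty).
  rewrite dl_addA at 1.
  rewrite <- !acompA.
  change (dl X U (V ⊕ W)) with (dl X U (half_add V W)).
  change (dl X (U ⊕ V) W) with (dl X (half_add U V) W).
  rewrite !hba_sum, <- !alift_acomp, !ident_l, !hba_sum by ok.
  now rewrite ar_addA.
Qed.

Lemma center_hom_addC (U V : half_braided A) :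
  @is_center_hom C A (half_add U V) (half_add V U) (addC A U V).
Proof.
apply center_homP; intros X.
change (Arr (addC A U V)) with (ac U V).
apply sum_eq with (X := X) (U := V) (V := U) (Y := (U ⊕ V) ⊗ X);
  try (simpl; ty).
rewrite acompA, hba_sum, <- ac_distR.
rewrite <- (ac_nat (typed_hba U X) (typed_hba V X)).
now rewrite acompA, <- dl_addC, <- acompA, hba_sum.
Qed.

Lemma center_hom_mulA (U V W : half_braided A) :
  @is_center_hom C A (half_mul U (half_mul V W)) (half_mul (half_mul U V) W)
    (mulA A U V W).
Proof.
apply center_hom_identity.
- simpl; now rewrite Arr_mulA, ?ob_mulA.
- intros X; rewrite !hba_prod.
  change (carrier (half_mul U V)) with (U ⊗ V).
  change (carrier (half_mul V W)) with (V ⊗ W).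
  rewrite alift_acompl, alift_acompr, <- !alift_ident by ok.
  now rewrite !ar_mulA, acompA.
Qed.

(** This is the identity family; l and r appear because [I ⊗ X] and [X ⊗ I] are equal to [X] only
    propositionally. *)
Definition half_one : half_braided A :=
  @HalfBraided C A I (fun X => iso_inv (mulr A X) ∘ mull A X).

Lemma hba_half_one (X : C) : hba half_one X = ι X.
Proof.
unfold hba; simpl; rewrite Arr_identity_l.
- apply Arr_mull.
- apply identity_inv, strict_mulr, hA.
Qed.

Lemma half_one_central : is_central half_one.
Proof.
apply central_is_central; split; [apply hba_typed|].
intros [X Y f| |X Y|X Y]; simpl; rewrite ?hba_half_one.
- rewrite ar_mull, ar_mulr, ident_l, ident_r; trivial; ok.
- reflexivity.
- rewrite !alift_ident, ident_l; trivial; ok.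
- rewrite !alift_ident, dl_one, ident_l; trivial; ok.
Qed.

Lemma center_hom_mull (U : half_braided A) :
  @is_center_hom C A (half_mul half_one U) U (mull A U).
Proof.
apply center_hom_identity.
- simpl; now rewrite Arr_mull, ?ob_mull.
- intros X; rewrite hba_prod, hba_half_one, alift_ident; simpl.
  rewrite ar_mull; apply ident_l; ok.
Qed.

Lemma center_hom_mulr (U : half_braided A) :
  @is_center_hom C A (half_mul U half_one) U (mulr A U).
Proof.
apply center_hom_identity.
- simpl; now rewrite Arr_mulr, ?ob_mulr.
- intros X; rewrite hba_prod, hba_half_one, alift_ident; simpl.
  rewrite ar_mulr; apply ident_r; ok.
Qed.

Lemma center_hom_distL (U V W : center_ob A) :
  @is_center_hom C A (half_mul U (half_add V W))
    (half_add (half_mul U V) (half_mul U W)) (distL A U V W).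
Proof.
apply center_homP; intros X.
change (Arr (distL A U V W)) with (dl U V W).
apply sum_eq with (X := X) (U := half_mul U V) (V := half_mul U W)
  (Y := U ⊗ (V ⊕ W) ⊗ X); try (simpl; ty).
rewrite acompA, hba_sum, dl_mulr, !hba_prod.
rewrite alift_acomp, <- acompA by ok.
rewrite <- (dl_nat (typed_ident U) (typed_hba V X) (typed_hba W X)).
change (carrier (half_mul U V)) with (U ⊗ V).
change (carrier (half_mul U W)) with (U ⊗ W).
change (carrier (half_add V W)) with (V ⊕ W).
rewrite <- hba_sum, alift_acompl, !acompA by ok.
f_equal.
(* By (Ann-2)(1) the two copies of L combine into L at [U ⊗ X]; naturality along [hba U X] replaces
   it by L at [X ⊗ U], which splits again. *)
rewrite <- dl_mulA, <- alift_ident.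
rewrite (dl_nat (typed_hba U X) (typed_ident V) (typed_ident W)).
now rewrite dl_mulA, acompA.
Qed.

Lemma center_hom_distR (U V W : half_braided A) :
  @is_center_hom C A (half_mul (half_add U V) W)
    (half_add (half_mul U W) (half_mul V W)) (distR A U V W).
Proof.
apply center_hom_identity.
- simpl; now rewrite Arr_distR, ?ob_distR.
- intros X.
  apply sum_eq with (X := X) (U := half_mul U W) (V := half_mul V W)
    (Y := (U ⊕ V) ⊗ W ⊗ X); try (simpl; ty).
  rewrite hba_sum, !hba_prod, acompA.
  change (carrier (half_mul U W)) with (U ⊗ W).
  change (carrier (half_mul V W)) with (V ⊗ W).
  change (carrier (half_add U V)) with (U ⊕ V).
  rewrite <- dl_mulr, <- alift_acompr by ok.
  now rewrite hba_sum, <- alift_ident, !ar_distR, <- alift_acomp by ok.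
Qed.

(** By (C2) the two sides involve the half-braiding of [U] at [V ⊗ X] and at [X ⊗ V]; its naturality
    along [hba V X] identifies them. *)
Lemma center_hom_braid (U V : center_ob A) :
  @is_center_hom C A (half_mul U V) (half_mul V U) (hb U V).
Proof.
apply center_homP; intros X; rewrite !hba_prod.
change (Arr (hb U V)) with (hba U V).
rewrite <- acompA, <- hba_mul, <- (hba_nat U (typed_hba V X)), hba_mul.
now rewrite acompA.
Qed.

(** * Choice of the half-braiding on zero, and opposites *)

Lemma zero_choice : exists u : forall X, hom (O ⊗ X) (X ⊗ O),
  forall X, dl X O O • Arr (u X) = Arr (u X) ⊞ Arr (u X).
Proof.
assert (F : forall X, {p : hom (O ⊗ X) (X ⊗ O) |
   dl X O O • Arr p = Arr p ⊞ Arr p}).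
{ intros X; apply constructive_indefinite_description.
  destruct (zero_exists X) as (p & [p' ->] & e); now exists p'. }
exists (fun X => proj1_sig (F X)); intros X; exact (proj2_sig (F X)).
Qed.

(** Dividing [hba Z] by [hba U] gives the half-braiding on [V], central by [central_difference]. The
    conclusion is about untyped arrows because [U ⊕ V] and the carrier of [Z] are only
    propositionally equal. *)
Lemma half_opp (U : center_ob A) (Z : center_ob A) (V : C) :
  carrier Z = O -> U ⊕ V = O ->
  exists V' : center_ob A, carrier V' = V /\
    (forall X, hba (half_add U V') X = hba Z X).
Proof.
intros eZ eV.
assert (F : forall X, {p : hom (V ⊗ X) (X ⊗ V) |
   hba U X ⊞ Arr p = dl X U V • hba Z X}).
{ intros X; apply constructive_indefinite_description.
  destruct (@add_divide (hba U X) (dl X U V • hba Z X) (U ⊗ X) (X ⊗ U)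
    (V ⊗ X) (X ⊗ V)) as (h & [p ->] & e).
  - ty.
  - eapply typed_conv; [eapply typed_acomp; [synth | synth |] | |]; trivial.
    + now rewrite eZ, eV.
    + now rewrite <- ob_distR, eZ, eV.
  - now exists p. }
pose (H := @HalfBraided C A V (fun X => proj1_sig (F X))).
assert (e : forall X, dl X U V • hba Z X = hba U X ⊞ hba H X).
{ intros X; symmetry; exact (proj2_sig (F X)). }
assert (c : is_central H).
{ apply central_is_central, (central_difference (w := hba Z)
    (is_central_central (half_central U))); trivial.
  - change (carrier H) with V; rewrite eV, <- eZ.
    apply is_central_central, half_central.
  - apply hba_typed. }
exists (CenterOb c); split; trivial; intros X.
apply sum_eq with (X := X) (U := U) (V := H) (Y := (U ⊕ V) ⊗ X).
- simpl; ty.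
- simpl; eapply typed_conv; [synth | |]; now rewrite eV, eZ.
- change (dl X U H • hba (half_add U H) X = dl X U V • hba Z X).
  now rewrite hba_sum, e.
Qed.

(** * The center as a braided Ann-category *)

Section Construction.

(** A parameter of the construction, because [zero_choice] provides it only as a propositional
    existence. *)
Variable u : forall X, hom (O ⊗ X) (X ⊗ O).
Hypothesis eu : forall X, dl X O O • Arr (u X) = Arr (u X) ⊞ Arr (u X).

Definition half_zero : half_braided A := @HalfBraided C A O u.

Lemma half_zero_central : is_central half_zero.
Proof. exact (central_is_central (zero_central (hba_typed half_zero) eu)). Qed.

Definition center_zero : center A := CenterOb half_zero_central.

Definition center_one : center A := CenterOb half_one_central.

Definition center_sum (U V : center A) : center A :=
  CenterOb (half_add_central U V).

Definition center_prod (U V : center A) : center A :=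
  CenterOb (half_mul_central U V).

Lemma center_hom_addl (U : half_braided A) :
  @is_center_hom C A (half_add half_zero U) U (addl A U).
Proof.
apply center_hom_identity.
- simpl; now rewrite Arr_addl, ob_addl.
- intros X.
  apply sum_eq with (X := X) (U := half_zero) (V := U) (Y := U ⊗ X);
    try (simpl; ty).
  rewrite hba_sum; change (carrier half_zero) with O.
  rewrite <- (zero_addl (hba_typed half_zero) eu).
  rewrite (lift_lr _ (typed_zero (hba_typed half_zero) X) (typed_hba U X)).
  now rewrite ar_addl.
Qed.

Lemma center_hom_addr (U : half_braided A) :
  @is_center_hom C A (half_add U half_zero) U (addr A U).
Proof.
apply center_hom_identity.
- simpl; now rewrite Arr_addr, ob_addr.
- intros X.
  apply sum_eq with (X := X) (U := U) (V := half_zero) (Y := U ⊗ X);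
    try (simpl; ty).
  rewrite hba_sum; change (carrier half_zero) with O.
  rewrite <- (zero_addr (hba_typed half_zero) eu).
  rewrite (lift_rl _ (typed_hba U X) (typed_zero (hba_typed half_zero) X)).
  now rewrite ar_addr.
Qed.

Definition center_iso (U V : center A) (f : iso (carrier U) (carrier V))
  (h : is_center_hom f) : iso U V :=
  let f' := CenterHom h in
  let g' := CenterHom (center_hom_inv h) in
  @Iso (center A) U V f' g'
    (@center_hom_eq C A U U (center_comp g' f') (center_id U) (isoK f))
    (@center_hom_eq C A V V (center_comp f' g') (center_id V) (isoVK f)).

Definition center_add_bifunctor : bifunctor (center A).
Proof.
refine (@Bifunctor (center A) center_sum (fun U U' V V' f g =>
  @CenterHom C A (center_sum U V) (center_sum U' V') _
    (center_hom_add (under_center f) (under_center g))) _ _);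
  intros; apply center_hom_eq; simpl.
- apply bi_id.
- apply bi_comp.
Defined.

Definition center_mul_bifunctor : bifunctor (center A).
Proof.
refine (@Bifunctor (center A) center_prod (fun U U' V V' f g =>
  @CenterHom C A (center_prod U V) (center_prod U' V') _
    (center_hom_mul (under_center f) (under_center g))) _ _);
  intros; apply center_hom_eq; simpl.
- apply bi_id.
- apply bi_comp.
Defined.

Definition center_add : monoidal (center A).
Proof.
refine (@Monoidal (center A) center_add_bifunctor center_zero
  (fun U V W => @center_iso (center_sum U (center_sum V W))
     (center_sum (center_sum U V) W) _ (center_hom_addA U V W))
  (fun U => @center_iso (center_sum center_zero U) U _ (center_hom_addl U))
  (fun U => @center_iso (center_sum U center_zero) U _ (center_hom_addr U))
  _ _ _ _ _);
  intros; apply center_hom_eq; simpl.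
- apply assoc_nat.
- apply lunit_nat.
- apply runit_nat.
- apply pentagon.
- apply triangle.
Defined.

Definition center_mul : monoidal (center A).
Proof.
refine (@Monoidal (center A) center_mul_bifunctor center_one
  (fun U V W => @center_iso (center_prod U (center_prod V W))
     (center_prod (center_prod U V) W) _ (center_hom_mulA U V W))
  (fun U => @center_iso (center_prod center_one U) U _ (center_hom_mull U))
  (fun U => @center_iso (center_prod U center_one) U _ (center_hom_mulr U))
  _ _ _ _ _);
  intros; apply center_hom_eq; simpl.
- apply assoc_nat.
- apply lunit_nat.
- apply runit_nat.
- apply pentagon.
- apply triangle.
Defined.

Definition center_addC (U V : center A) :
  iso (center_add U V) (center_add V U) :=
  @center_iso (center_sum U V) (center_sum V U) _ (center_hom_addC U V).

Definition center_distL (U V W : center A) :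
  iso (center_mul U (center_add V W))
      (center_add (center_mul U V) (center_mul U W)) :=
  @center_iso (center_prod U (center_sum V W))
    (center_sum (center_prod U V) (center_prod U W)) _ (center_hom_distL U V W).

Definition center_distR (U V W : center A) :
  iso (center_mul (center_add U V) W)
      (center_add (center_mul U W) (center_mul V W)) :=
  @center_iso (center_prod (center_sum U V) W)
    (center_sum (center_prod U W) (center_prod V W)) _ (center_hom_distR U V W).

Lemma center_groupoid : groupoid (center A).
Proof.
intros U V [f hf].
destruct (scg_groupoid (add_scg A) f) as (g & gf & fg).
exists (CenterHom (@center_hom_inv U V (Iso gf fg) hf)).
split; apply center_hom_eq; trivial.
Qed.

Lemma center_opposite (U : center A) :
  exists V, inhabited (iso (center_add U V) center_zero).
Proof.
destruct (hinv U) as [V e].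
destruct (@half_opp U center_zero V eq_refl e) as (V' & eV & h).
(* The isomorphism is the identity of [O]; stating it existentially allows rewriting its source to
   [O]. *)
assert (F : exists f : iso (U ⊕ carrier V') O, Arr f = ι (U ⊕ carrier V')).
{ rewrite eV, e.
  exists (@Iso C O O (idm O) (idm O) (comp_idl _) (comp_idl _)); reflexivity. }
destruct F as [f ef].
exists V'; constructor.
exact (@center_iso (center_sum U V') center_zero f
  (@center_hom_identity (half_add (half U) (half V')) half_zero f ef h)).
Qed.

Lemma center_scg : is_symmetric_categorical_group (M := center_add) center_addC.
Proof.
assert (S := scg_symmetry (add_scg A)).
split; [split; [split|]| |]; intros.
- apply center_hom_eq; apply (braiding_nat (symmetry_braiding S)).
- apply center_hom_eq; apply (hexagon1 (symmetry_braiding S)).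
- apply center_hom_eq; apply (hexagon2 (symmetry_braiding S)).
- apply center_hom_eq; apply (symmetry_invol S).
- exact center_groupoid.
- apply center_opposite.
Qed.

Lemma center_ann_laws : ann_laws center_addC center_distL center_distR.
Proof.
assert (a := ann_ax A); split; intros; apply center_hom_eq.
- apply (distL_nat a).
- apply (distR_nat a).
- apply (ann1_La a).
- apply (ann1_Lc a).
- apply (ann1_Ra a).
- apply (ann1_Rc a).
- apply (ann2_1 a).
- apply (ann2_2 a).
- apply (ann2_3 a).
- apply (ann2_4 a).
- apply (ann3_L a).
- apply (ann3_R a).
Qed.

Definition center_ann : ann_structure (center A) :=
  AnnStructure center_scg center_ann_laws.

(** Half-braidings are not assumed invertible; an inverse exists because [C] is a groupoid, and is
    chosen by indefinite description. *)
Definition hb_iso (U V : center A) :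
  iso (carrier U ⊗ carrier V) (carrier V ⊗ carrier U).
Proof.
destruct (constructive_indefinite_description _
  (scg_groupoid (add_scg A) (hb (half U) (carrier V)))) as (g & e & e').
exact (Iso e e').
Defined.

Lemma hb_isoE (U V : center A) : iso_hom (hb_iso U V) = hb (half U) (carrier V).
Proof.
unfold hb_iso.
now destruct (constructive_indefinite_description _ _) as (g & e & e').
Qed.

Lemma center_hom_hb_iso (U V : center A) :
  @is_center_hom C A (half_mul (half U) (half V)) (half_mul (half V) (half U))
    (hb_iso U V).
Proof. rewrite hb_isoE; apply center_hom_braid. Qed.

Definition center_braid (U V : center A) :
  iso (center_mul U V) (center_mul V U) :=
  @center_iso (center_prod U V) (center_prod V U) _ (center_hom_hb_iso U V).

Lemma center_braiding : is_braiding center_braid.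
Proof.
split.
(* Naturality in the first variable is the condition on morphisms of the center; in the second it is
   naturality of the half-braiding. *)
- intros U U' V V' [f hf] [g hg]; apply center_hom_eq; simpl; rewrite !hb_isoE.
  push_goal; rewrite !Arr_hb.
  rewrite center_homP in hf.
  rewrite (lift_lr _ (typed_Arr f) (typed_Arr g)), acompA, hf, <- acompA.
  rewrite (hba_nat U (typed_Arr g)), acompA.
  now rewrite <- (lift_rl _ (typed_Arr g) (typed_Arr f)).
(* The first hexagon is the formula for the half-braiding of a product. *)
- intros U V W; apply center_hom_eq; simpl; rewrite !hb_isoE.
  push_goal.
  transitivity (hba (half_mul (half U) (half V)) W).
  + symmetry; apply hba_prod.
  + exact (f_equal (@Arr C _ _) (eq_sym (hb_isoE (center_prod U V) W))).
(* The second hexagon is (C2). *)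
- intros U V W; apply center_hom_eq; simpl; rewrite !hb_isoE.
  push_goal.
  transitivity (hba (half U) (V ⊗ W)).
  + symmetry; apply hba_mul.
  + exact (f_equal (@Arr C _ _) (eq_sym (hb_isoE U (center_prod V W)))).
Qed.

Lemma center_braid_zero :
  iso_hom (center_braid center_zero center_zero) = idm _.
Proof.
apply center_hom_eq; transitivity (u O).
{ exact (hb_isoE center_zero center_zero). }
apply Arr_inj; transitivity (ι O).
- exact (zero_zero (hba_typed half_zero) eu).
- rewrite <- (ob_mul0 O) at 1; reflexivity.
Qed.

Definition center_braided_ann : braided_ann_structure (center A).
Proof.
refine (@BraidedAnnStructure (center A) center_ann center_braid center_braiding
  center_braid_zero _).
intros U V W; apply center_hom_eq.
(* Axiom (6) for the braiding is (C3). *)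
assert (e := hb_add (half_central U) (carrier V) (carrier W)).
change (carrier V ⊕ carrier W) with (carrier (center_sum V W)) in e.
rewrite <- !hb_isoE in e; exact e.
Defined.

End Construction.

End Strict.

Theorem theorem7p3 (C : category) (A : ann_structure C)
    (hA : almost_strict A)
    (hinv : forall X : C, exists X' : C, add A X X' = zero A) :
  exists B : braided_ann_structure (center A),
    center_operations B /\ center_constraints B.
Proof.
destruct (zero_choice hA hinv) as [u eu].
exists (center_braided_ann hA hinv eu); split; split; intros; try constructor.
(* Only the braiding remains: it is packaged through a chosen inverse, so [hb_isoE] is required. *)
simpl; unfold forget; simpl; rewrite hb_isoE; constructor.
Qed.
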